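(* Let $H:\mathbb{R}^2\times\mathbb{R}\times\mathbb{R}^2\times\mathcal{S}^{2\times2}\to\mathbb{R}$ be a function such that $H(\cdot,u,\nabla u,\nabla^2u)$ is Möbius invariant in $\mathbb{R}^2$. Then there exists a function $F:\mathcal{S}^{2\times2}\to\mathbb{R}$ that is invariant under orthogonal conjugation, i.e. $$F(O^{-1}MO)=F(M)\qquad\text{for all }M\in\mathcal{S}^{2\times2},\ O\in O(2),$$ such that $$H(\cdot,u,\nabla u,\nabla^2u)=F(A^u)$$ (i.e. this identity holds for every $u\in C^2(\mathbb{R}^2)$ at every point of $\mathbb{R}^2$).
   Context: $\mathcal{S}^{2\times2}$ denotes the set of $2\times2$ real symmetric matrices and $O(2)$ the set of real orthogonal $2\times2$ matrices. A Möbius transformation is a transformation generated by a finite composition of the maps $\phi(x)=x+x_0$ ($x_0\in\mathbb{R}^2$), $\phi(x)=\lambda x$ ($\lambda$ a nonzero constant), $\phi(x)=Ox$ ($O$ an orthogonal matrix), and $\phi(x)=x/|x|^2$ in $\mathbb{R}^2$. Equivalently, with $z=x_1+\sqrt{-1}x_2$, it is a map $z\mapsto\frac{az+b}{cz+d}$ or $z\mapsto\frac{a\bar z+b}{c\bar z+d}$ with $a,b,c,d\in\mathbb{C}$, $ad-bc\neq0$. For a $C^2$ function $u$ and a Möbius transformation $\psi$, put $u_\psi:=u\circ\psi+\ln|J_\psi|$, where $|J_\psi|$ is the absolute value of the Jacobian determinant of $\psi$. $H(\cdot,u,\nabla u,\nabla^2u)$ is called Möbius invariant if for every Möbius transformation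 $\psi$ and every $u\in C^2(\mathbb{R}^2)$, $$H(\cdot,u_\psi,\nabla u_\psi,\nabla^2u_\psi)=H(\cdot,u,\nabla u,\nabla^2u)\circ\psi$$ on $\mathbb{R}^2$ (at every point which is not a pole of $\psi$). Here $H(\cdot,u,\nabla u,\nabla^2u)$ denotes the function $x\mapsto H(x,u(x),\nabla u(x),\nabla^2u(x))$. No regularity is assumed on $H$ or $F$. For a $C^2$ function $u$, $A^u$ is the $2\times2$ symmetric-matrix-valued function $$A^u=-e^{-u}\nabla^2u+\frac12e^{-u}\,du\otimes du-\frac14e^{-u}|\nabla u|^2I,$$ where $\nabla^2u$ is the Hessian matrix, $(du\otimes du)_{ij}=\partial_iu\,\partial_ju$, and $I$ is the $2\times2$ identity matrix. *)

(* Defs.v *)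
From HB Require Import structures.
From mathcomp Require Import all_boot all_order all_algebra.
From mathcomp Require Import sesquilinear.
From mathcomp Require Import all_classical all_reals all_analysis.
Set Implicit Arguments.
Unset Strict Implicit.
Unset Printing Implicit Defensive.
Import Order.TTheory GRing.Theory Num.Theory.
Import numFieldNormedType.Exports.
Local Open Scope classical_set_scope.
Local Open Scope ring_scope.

(* Points and gradients are row vectors, so a matrix O acts on a point x by
   O x = (x *m O^T) in row form. *)

Section SymmetricMatrices.
Context {R : realType}.

Definition sym2 := {M : 'M[R]_2 | M \is symmetricmx}.

Lemma sym2P (M : 'M[R]_2) : (M \is symmetricmx) = (M^T == M).
Proof.
by rewrite qualifE /= expr0 scale1r map_mx_id// eq_sym.
Qed.

Lemma sym2_0 : (0 : 'M[R]_2) \is symmetricmx.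
Proof. by rewrite sym2P trmx0. Qed.

(* A symmetric matrix seen as an element of sym2.  The default value (zero) is
   only taken at non-symmetric matrices. *)
Definition to_sym2 (M : 'M[R]_2) : sym2 := insubd (Sub 0 sym2_0 : sym2) M.

Lemma to_sym2K (M : 'M[R]_2) : M \is symmetricmx -> \val (to_sym2 M) = M.
Proof. exact: insubdK. Qed.

Definition orthogonal2 (O : 'M[R]_2) : Prop := O *m O^T = 1%:M.

Definition conj2 (O : 'M[R]_2) (M : sym2) : sym2 :=
  to_sym2 (invmx O *m \val M *m O).

Lemma val_conj2 (O : 'M[R]_2) (M : sym2) :
  orthogonal2 O -> \val (conj2 O M) = invmx O *m \val M *m O.
Proof.
move=> OO; have Ou : O \in unitmx by have [] := mulmx1_unit OO.
have OV : invmx O = O^T by rewrite -[LHS]mulmx1 -OO mulKmx.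
apply: to_sym2K; rewrite sym2P OV !trmx_mul trmxK.
by have := valP M; rewrite /= sym2P => /eqP ->; rewrite mulmxA.
Qed.

Definition orthogonally_invariant (F : sym2 -> R) : Prop :=
  forall (M : sym2) (O : 'M[R]_2), orthogonal2 O -> F (conj2 O M) = F M.

End SymmetricMatrices.
Arguments sym2 : clear implicits.

Section Calculus.
Context {R : realType}.
Implicit Types (u : 'rV[R]_2 -> R) (x : 'rV[R]_2).

Definition partial (i : 'I_2) u x : R := 'D_('e_i) u x.

Definition gradient u x : 'rV[R]_2 := \row_i partial i u x.

Definition hessian u x : 'M[R]_2 :=
  \matrix_(i, j) partial i (partial j u) x.

Definition C1 u : Prop :=
  (forall x, differentiable u x) /\ (forall i, continuous (partial i u)).

Definition C2 u : Prop := C1 u /\ forall i, C1 (partial i u).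

(* The norms of the library on matrices are sup norms; this is the square of
   the Euclidean one. *)
Definition sqnorm x : R := \sum_i x 0 i ^+ 2.

(* If u is C^2 near x then, by Schwarz's theorem, hessian u x is symmetric and
   the two uses of to_sym2 below do not change the matrix. *)
Definition eval_jet (H : 'rV[R]_2 -> R -> 'rV[R]_2 -> sym2 R -> R) u x : R :=
  H x (u x) (gradient u x) (to_sym2 (hessian u x)).

Definition Amatrix u x : 'M[R]_2 :=
  - expR (- u x) *: hessian u x
  + (2^-1 * expR (- u x)) *: (\matrix_(i, j) (partial i u x * partial j u x))
  - (4^-1 * expR (- u x) * sqnorm (gradient u x)) *: 1%:M.

Definition A_ u x : sym2 R := to_sym2 (Amatrix u x).

End Calculus.

Section Moebius.
Context {R : realType}.

(* R^2 with a point at infinity, which is None. *)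
Notation sphere := (one_point_compactification 'rV[R]_2).

Definition fix_infty (f : 'rV[R]_2 -> 'rV[R]_2) (p : sphere) : sphere :=
  if p is Some x then Some (f x) else None.

Definition inversion (p : sphere) : sphere :=
  if p is Some x then
    if x == 0 then None else Some ((sqnorm x)^-1 *: x)
  else Some 0.

(* Compositions are taken on the sphere, so that a point of R^2 at which an
   intermediate map takes the value infinity is not a pole unless the whole
   composition sends it to infinity. *)
Inductive moebius : (sphere -> sphere) -> Prop :=
| moebius_translation (x0 : 'rV[R]_2) :
    moebius (fix_infty (fun x => x + x0))
| moebius_scaling (l : R) : l != 0 ->
    moebius (fix_infty (fun x => l *: x))
| moebius_orthogonal (O : 'M[R]_2) : orthogonal2 O ->
    moebius (fix_infty (fun x => x *m O^T))
| moebius_inversion : moebius inversion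
| moebius_comp (f g : sphere -> sphere) :
    moebius f -> moebius g -> moebius (f \o g).

Definition pole (psi : sphere -> sphere) (x : 'rV[R]_2) : Prop :=
  psi (Some x) = None.

(* The value 0 at the pole (there is at most one) is a dummy: the map is only
   used near points which are not poles. *)
Definition finite_part (psi : sphere -> sphere) (x : 'rV[R]_2) : 'rV[R]_2 :=
  odflt 0 (psi (Some x)).

Definition pullback (psi : 'rV[R]_2 -> 'rV[R]_2) (u : 'rV[R]_2 -> R)
    (x : 'rV[R]_2) : R :=
  u (psi x) + ln `|\det ('J psi x)|.

Definition moebius_invariant
    (H : 'rV[R]_2 -> R -> 'rV[R]_2 -> sym2 R -> R) : Prop :=
  forall psi, moebius psi ->
  forall u : 'rV[R]_2 -> R, C2 u ->
  forall x : 'rV[R]_2, ~ pole psi x ->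
    eval_jet H (pullback (finite_part psi) u) x
    = eval_jet H u (finite_part psi x).

End Moebius.

(* Main.v *)
From HB Require Import structures.
Require Import Defs.
From mathcomp Require Import all_boot all_order all_algebra.
From mathcomp Require Import all_classical all_reals all_analysis.
From mathcomp Require Import ring.
Set Implicit Arguments.
Unset Strict Implicit.
Unset Printing Implicit Defensive.
Import Order.TTheory GRing.Theory Num.Theory.
Import numFieldNormedType.Exports.
Local Open Scope classical_set_scope.
Local Open Scope ring_scope.

(* Put F M := H 0 0 0 (- M).  Given u and x0, the Moebius map
     psi y = x0 + l (y + |y|^2 a) / (1 + 2 a.y + |a|^2 |y|^2)
   has psi 0 = x0 and l as derivative at 0, and its Jacobian determinant is
   (l / (1 + 2 a.y + |a|^2 |y|^2))^2.  With l = exp (- u x0 / 2) and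
   a = (l / 4) grad u x0, the function u_psi vanishes at 0 together with its
   gradient, and its Hessian at 0 is - A^u x0; invariance under psi therefore
   reads H (x0, u, grad u, hess u) = F (A^u x0).
   The orthogonal invariance of F is the invariance of H under x |-> O x,
   applied to the quadratic form - x M x^T / 2 at the origin. *)

(** * Differentials *)

Section Differentials.
Context {R : realType} {V : normedModType R}.

(** The first-order expansion at [x] only sees the germ of the function. This allows differentiating
    maps whose closed formulas hold only near a point, away from poles. *)
Lemma near_eq_is_diff {W : normedModType R} (f g df : V -> W) (x : V) :
  (\near x, f x = g x) -> is_diff x f df -> is_diff x g df.
Proof.
move=> fg dfx.
have [dc fE] : continuous ('d f x) /\
    g \o shift x = cst (g x) + 'd f x +o_ 0 id.
  split; first exact: diff_continuous.
  apply/eqaddoP => e e0.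
  have /diff_locally/eqaddoP/(_ _ e0) fo : differentiable f x by [].
  have fg0 : \forall h \near (0 : V), f (h + x) = g (h + x).
    by rewrite (near_shift x) /=; near=> y; rewrite /= sub0r subrK; near: y.
  apply: filterS2 fg0 fo => h fgh.
  by rewrite !fctE /= fgh (nbhs_singleton fg).
have dg : 'd g x = 'd f x :> (V -> W) by exact: diff_unique.
apply: DiffDef; last by rewrite dg diff_val.
by apply/diff_locallyP; rewrite dg.
Unshelve. all: by end_near. Qed.

(* The library instances are stated with the pointwise operations f + g, f * g
   on functions, which do not unify with the lambda-terms used below. *)
Lemma is_diff_add (f g df dg : V -> R) x : is_diff x f df -> is_diff x g dg ->
  is_diff x (fun y => f y + g y) (fun v => df v + dg v).
Proof. by move=> *; exact: is_diffD. Qed.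

Lemma is_diff_const (c : R) (x : V) : is_diff x (fun=> c) (fun=> 0).
Proof. exact: is_diff_cst. Qed.

Lemma is_diff_scale (c : R) (f df : V -> R) x : is_diff x f df ->
  is_diff x (fun y => c * f y) (fun v => c * df v).
Proof. by move=> *; exact: is_diffZ. Qed.

Lemma is_diff_mul (f g df dg : V -> R) x : is_diff x f df -> is_diff x g dg ->
  is_diff x (fun y => f y * g y) (fun v => f x * dg v + g x * df v).
Proof. by move=> *; exact: is_diffM. Qed.

Lemma is_diff_inv (f df : V -> R) x : f x != 0 -> is_diff x f df ->
  is_diff x (fun y => (f y)^-1) (fun v => - (f x) ^- 2 * df v).
Proof.
move=> fx0 dfx; apply: DiffDef; first exact: differentiableV.
by rewrite diffV// diff_val.
Qed.

Lemma is_diff_ln (f df : V -> R) x : 0 < f x -> is_diff x f df ->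
  is_diff x (fun y => ln (f y)) (fun v => (f x)^-1 * df v).
Proof.
move=> fx0 dfx.
have dln : is_diff (f x) (@ln R) (fun h => h * (f x)^-1).
  have [d1 d2] := is_derive1_ln fx0.
  apply: DiffDef; first exact/derivable1_diffP.
  by rewrite diff1E; [rewrite derive1E d2 | exact/derivable1_diffP].
suff -> : (fun v => (f x)^-1 * df v) = (fun h => h * (f x)^-1) \o df.
  exact: is_diff_comp dfx dln.
by apply/funext => v /=; rewrite mulrC.
Qed.

Lemma is_diff_row n (f df : V -> 'rV[R]_n) x :
  (forall k, is_diff x (fun y => f y 0 k) (fun v => df v 0 k)) ->
  is_diff x f df.
Proof.
move=> dfx.
have sumE (g : V -> 'rV[R]_n) : g = \sum_k (fun y => g y 0 k *: 'e_k).
  by apply/funext => y; rewrite fct_sumE -row_sum_delta.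
rewrite (sumE f) (sumE df).
apply: (big_ind2 (fun f df : V -> 'rV[R]_n => is_diff x f df)).
- exact: is_diff_cst.
- by move=> f1 df1 f2 df2 *; exact: is_diffD.
- move=> k _; apply: DiffDef; first exact: differentiableZl.
  by rewrite diffZl// diff_val.
Qed.

End Differentials.

Lemma is_diff_coord {R : realType} n (x : 'rV[R]_n) k :
  is_diff x (fun y : 'rV[R]_n => y 0 k) (fun v => v 0 k).
Proof.
apply: DiffDef; first exact: differentiable_coord.
(* The coordinate is bundled as a linear map: a continuous linear map is its own differential. *)
have @f : {linear 'rV[R]_n -> R}.
  by exists (fun y : 'rV[R]_n => y 0 k); do 2![eexists]; do ?[constructor];
     rewrite ?mxE// => ? *; rewrite ?mxE//; move=> ?; rewrite !mxE.
by rewrite (_ : (fun _ => _) = f) //; apply: diff_lin; exact: coord_continuous.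
Qed.

(** * The plane *)

Lemma ord2P (i : 'I_2) : {i = 0} + {i = 1}.
Proof. by case: i => [[|[|//]] i]; [left|right]; exact: val_inj. Qed.

Lemma sum2E {V : nmodType} (f : 'I_2 -> V) : \sum_i f i = f 0 + f 1.
Proof. by rewrite big_ord_recl big_ord1; congr (_ + f _); exact: val_inj. Qed.

Lemma det_mx2 (K : comNzRingType) (A : 'M[K]_2) :
  \det A = A 0 0 * A 1 1 - A 0 1 * A 1 0.
Proof.
rewrite (expand_det_row _ 0) sum2E /cofactor !det_mx11 !mxE /= addn0 expr0.
have -> : lift 0 0 = 1 :> 'I_2 by exact: val_inj.
have -> : lift 1 0 = 0 :> 'I_2 by exact: val_inj.
by rewrite expr1 mul1r mulN1r mulrN.
Qed.

Section Plane.
Context {R : realType}.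
Implicit Types (x y v : 'rV[R]_2) (u : 'rV[R]_2 -> R).

Definition dot x y : R := x 0 0 * y 0 0 + x 0 1 * y 0 1.

Lemma sqnormE x : sqnorm x = x 0 0 ^+ 2 + x 0 1 ^+ 2.
Proof. exact: sum2E. Qed.

Lemma sqnorm_eq0 x : (sqnorm x == 0) = (x == 0).
Proof.
apply/eqP/eqP => [|->]; last by rewrite sqnormE !mxE expr0n addr0.
rewrite /sqnorm => /eqP; rewrite psumr_eq0; last by move=> *; exact: sqr_ge0.
move=> /allP x0; apply/rowP => i; rewrite mxE; apply/eqP; rewrite -sqrf_eq0.
by have := x0 i; rewrite mem_index_enum => /(_ isT).
Qed.

Lemma is_diff_dot y x : is_diff x (dot y) (dot y).
Proof. by apply: is_diff_add; apply: is_diff_scale; exact: is_diff_coord. Qed.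

Lemma is_diff_sqnorm x : is_diff x sqnorm (fun v => 2 * dot x v).
Proof.
have -> : @sqnorm R = fun y => y 0 0 * y 0 0 + y 0 1 * y 0 1.
  by apply/funext => y; rewrite sqnormE !expr2.
have d := is_diff_add (is_diff_mul (is_diff_coord x 0) (is_diff_coord x 0))
  (is_diff_mul (is_diff_coord x 1) (is_diff_coord x 1)).
by apply: (is_diff_eq d); apply/funext => v; rewrite /dot; ring.
Qed.

Lemma partialE u du x i : is_diff x u du -> partial i u x = du 'e_i.
Proof. by move=> d; rewrite /partial deriveE// diff_val. Qed.

Lemma diff_partial u x v : differentiable u x ->
  'd u x v = v 0 0 * partial 0 u x + v 0 1 * partial 1 u x.
Proof.
move=> du; rewrite {1}(row_sum_delta v) linear_sum sum2E !linearZ /=.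
by rewrite /partial !deriveE.
Qed.

Lemma is_diff_comp_row {V : normedModType R} u (g dg : V -> 'rV[R]_2) z :
  differentiable u (g z) -> is_diff z g dg ->
  is_diff z (fun t => u (g t))
    (fun h => dg h 0 0 * partial 0 u (g z) + dg h 0 1 * partial 1 u (g z)).
Proof.
move=> du gd; have d := is_diff_comp gd (differentiableP du).
by apply: (is_diff_eq d); apply/funext => v /=; rewrite diff_partial.
Qed.

(** Off symmetric matrices both sides are the default 0, which is its own negative; so this applies
    to [Amatrix u x] as it stands. *)
Lemma to_sym2N (M : 'M[R]_2) : to_sym2 (- \val (to_sym2 M)) = to_sym2 (- M).
Proof.
have symN (N : 'M[R]_2) : (- N \is symmetricmx) = (N \is symmetricmx).
  by rewrite !sym2P linearN /= eqr_opp.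
apply: val_inj; rewrite /to_sym2 !val_insubd /= !symN.
by case: (boolP (M \is symmetricmx)) => [-> //|_]; rewrite oppr0 if_same.
Qed.

End Plane.

(** * Quadratic forms and orthogonal invariance *)

Section Quadratic.
Context {R : realType}.
Implicit Types (x v : 'rV[R]_2) (M O : 'M[R]_2).

(** For symmetric [M] the factor - 1/2 makes the Hessian - M, so every M is the value of A at the
    origin for some function with vanishing 1-jet there. *)
Definition quad M x : R := - 2^-1 * (x *m M *m x^T) 0 0.

Lemma is_diff_quad M x : M \is symmetricmx ->
  is_diff x (quad M) (fun v => - (x *m M *m v^T) 0 0).
Proof.
rewrite sym2P => /eqP sM.
have M10 : M 1 0 = M 0 1 by rewrite -{1}sM mxE.
have -> : quad M = fun x => - 2^-1 * (M 0 0 * (x 0 0 * x 0 0) +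
    2 * M 0 1 * (x 0 0 * x 0 1) + M 1 1 * (x 0 1 * x 0 1)).
  by apply/funext => y; rewrite /quad !mxE sum2E !mxE !sum2E M10; ring.
have d := is_diff_scale (- 2^-1) (is_diff_add (is_diff_add
 (is_diff_scale (M 0 0) (is_diff_mul (is_diff_coord x 0) (is_diff_coord x 0)))
 (is_diff_scale (2 * M 0 1)
    (is_diff_mul (is_diff_coord x 0) (is_diff_coord x 1))))
 (is_diff_scale (M 1 1)
    (is_diff_mul (is_diff_coord x 1) (is_diff_coord x 1)))).
apply: (is_diff_eq d); apply/funext => v.
by rewrite !mxE sum2E !mxE !sum2E M10; field.
Qed.

Lemma partial_quad M i : M \is symmetricmx ->
  partial i (quad M) = fun x => - (x *m M) 0 i.
Proof.
move=> sM; apply/funext => x; rewrite (partialE _ (is_diff_quad x sM)).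
rewrite !mxE (bigD1 i)//= big1 ?addr0; first by rewrite !mxE !eqxx mulr1.
by move=> j ji; rewrite !mxE (negbTE ji) mulr0.
Qed.

(** A partial derivative of a quadratic form is linear, hence its own differential. *)
Lemma is_diff_partial_quad M i x : M \is symmetricmx ->
  is_diff x (partial i (quad M)) (partial i (quad M)).
Proof.
move=> sM; rewrite partial_quad//.
have -> : (fun x => - (x *m M) 0 i) =
    fun x => (- M 0 i) * x 0 0 + (- M 1 i) * x 0 1.
  by apply/funext => y; rewrite !mxE sum2E; ring.
by apply: is_diff_add; apply: is_diff_scale; exact: is_diff_coord.
Qed.

Lemma partial_partial_quad M i j x : M \is symmetricmx ->
  partial i (partial j (quad M)) x = - M i j.
Proof.
move=> sM; rewrite (partialE _ (is_diff_partial_quad j x sM)) partial_quad//.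
by rewrite -rowE mxE.
Qed.

Lemma C2_quad M : M \is symmetricmx -> C2 (quad M).
Proof.
move=> sM; split; [split=> [x|i x]|move=> i; split=> [x|j x]].
- by have [] := is_diff_quad x sM.
- by apply: differentiable_continuous; have [] := is_diff_partial_quad i x sM.
- by have [] := is_diff_partial_quad i x sM.
- rewrite (_ : partial j _ = cst (- M j i)); first exact: cst_continuous.
  by apply/funext => y; exact: partial_partial_quad.
Qed.

Lemma eval_jet_quad (H : 'rV[R]_2 -> R -> 'rV[R]_2 -> sym2 R -> R) M :
  M \is symmetricmx -> eval_jet H (quad M) 0 = H 0 0 0 (to_sym2 (- M)).
Proof.
move=> sM; rewrite /eval_jet; congr (H _ _ _ (to_sym2 _)).
- by rewrite /quad !mul0mx mxE mulr0.
- by apply/rowP => i; rewrite !mxE partial_quad// mul0mx mxE oppr0.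
- by apply/matrixP => i j; rewrite !mxE partial_partial_quad.
Qed.

Lemma jacobian_orthogonal O x :
  'J (finite_part (fix_infty (fun x => x *m O^T))) x = O^T.
Proof.
have [dO dOE] : is_diff x (fun x => x *m O^T) (fun v => v *m O^T).
  apply: is_diff_row => k.
  have -> : (fun y : 'rV[R]_2 => (y *m O^T) 0 k) =
      fun y => O k 0 * y 0 0 + O k 1 * y 0 1.
    by apply/funext => y; rewrite !mxE sum2E !mxE; ring.
  by apply: is_diff_add; apply: is_diff_scale; exact: is_diff_coord.
apply/row_matrixP => i; rewrite !rowE -deriveEjacobian//.
by rewrite deriveE// dOE.
Qed.

(** The logarithmic term vanishes because (det O)^2 = det (O O^T) = 1, and O^T = O^-1 turns the
    substitution into a conjugation. *)
Lemma pullback_orthogonal_quad O M : orthogonal2 O ->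
  pullback (finite_part (fix_infty (fun x => x *m O^T))) (quad M) =
  quad (invmx O *m M *m O).
Proof.
move=> OO; have Ou : O \in unitmx by have [] := mulmx1_unit OO.
have OV : invmx O = O^T by rewrite -[LHS]mulmx1 -OO mulKmx.
apply/funext => x; rewrite /pullback jacobian_orthogonal det_tr.
have -> : `|\det O| = 1.
  apply/eqP; rewrite -sqr_norm_eq1 ?num_real//.
  by rewrite expr2 -{2}det_tr -det_mulmx OO det1 eqxx.
by rewrite ln1 addr0 /finite_part /= /quad trmx_mul trmxK OV !mulmxA.
Qed.

Lemma orthogonally_invariant_at0
    (H : 'rV[R]_2 -> R -> 'rV[R]_2 -> sym2 R -> R) :
  moebius_invariant H ->
  orthogonally_invariant (fun S => H 0 0 0 (to_sym2 (- \val S))).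
Proof.
move=> Hinv S O OO /=.
rewrite -(eval_jet_quad H (valP (conj2 O S))) -(eval_jet_quad H (valP S)).
rewrite (val_conj2 S OO) -(pullback_orthogonal_quad _ OO).
rewrite (Hinv _ (moebius_orthogonal OO) _ (C2_quad (valP S)) 0); last by [].
by congr (eval_jet H _ _); exact: mul0mx.
Qed.

End Quadratic.

(** * Special conformal maps *)

Section SpecialConformal.
Context {R : realType} (x0 a : 'rV[R]_2) (l : R).
Implicit Types y v h : 'rV[R]_2.

Notation sphere := (one_point_compactification 'rV[R]_2).

(** The translation by [a] conjugated by the inversion fixes 0 and is tangent to the identity there,
    with second-order term |y|^2 a - 2 (a.y) y. Thus [x0], [l] and [a] control the image of 0, the
    derivative and the second-order part. *)
Definition special_conformal : sphere -> sphere :=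
  fix_infty (fun x => x + x0) \o (fix_infty (fun x => l *: x) \o
   (inversion \o (fix_infty (fun x => x + a) \o inversion))).

Lemma moebius_special_conformal : l != 0 -> moebius special_conformal.
Proof.
by move=> l0; do !apply: moebius_comp; do ?[exact: moebius_translation|
  exact: moebius_scaling|exact: moebius_inversion].
Qed.

(** Closed form of [special_conformal] away from its pole. The prefix [d] marks the differential at
    [y] in direction [v], kept explicit so that it can be differentiated again in [y]. *)
Definition sc_den y := 1 + 2 * dot a y + sqnorm a * sqnorm y.
Definition dsc_den y v := 2 * dot a v + sqnorm a * (2 * dot y v).
Definition sc_num y := y + sqnorm y *: a.
Definition dsc_num y v := v + (2 * dot y v) *: a.
Definition sc y := x0 + (l / sc_den y) *: sc_num y.
Definition dsc y v := l *: ((sc_den y)^-1 *: dsc_num y v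
  - (dsc_den y v / sc_den y ^+ 2) *: sc_num y).

Lemma special_conformalE y : sc_den y != 0 ->
  special_conformal (Some y) = Some (sc y).
Proof.
move=> dy; rewrite /special_conformal /= /inversion.
(* The origin goes to infinity under the first inversion and returns to 0 under the second. *)
have [->|yn0] := eqVneq y 0.
  rewrite /= /sc /sc_num scaler0 sqnormE !mxE expr0n addr0 scale0r addr0.
  by rewrite scaler0 addr0 add0r.
have sy : sqnorm y != 0 by rewrite sqnorm_eq0.
set z := (sqnorm y)^-1 *: y + a.
(* Hence [z], the argument of the second inversion, is nonzero wherever the denominator is. *)
have zE : sqnorm z * sqnorm y = sc_den y.
  move: sy; rewrite /z /sc_den /dot !sqnormE !mxE => sy; field; exact: sy.
have sz : sqnorm z != 0 by apply: contra dy => /eqP z0; rewrite -zE z0 mul0r.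
rewrite /= ifN -?sqnorm_eq0//=; congr Some.
rewrite addrC; congr (_ + _); rewrite -zE /z /sc_num.
by apply/rowP => k; rewrite !mxE; field; rewrite sy sz.
Qed.

Lemma is_diff_sc_den y : is_diff y sc_den (dsc_den y).
Proof.
have d := is_diff_add
  (is_diff_add (is_diff_const 1 y) (is_diff_scale 2 (is_diff_dot a y)))
  (is_diff_scale (sqnorm a) (is_diff_sqnorm y)).
by apply: (is_diff_eq d); apply/funext => v; rewrite /dsc_den; ring.
Qed.

Lemma is_diff_sc_num y k :
  is_diff y (fun y => sc_num y 0 k) (fun v => dsc_num y v 0 k).
Proof.
have -> : (fun y => sc_num y 0 k) = fun y => y 0 k + a 0 k * sqnorm y.
  by apply/funext => z; rewrite /sc_num !mxE; ring.
have d := is_diff_add (is_diff_coord y k)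
  (is_diff_scale (a 0 k) (is_diff_sqnorm y)).
by apply: (is_diff_eq d); apply/funext => v; rewrite /dsc_num !mxE; ring.
Qed.

(** From here the direction [v] is fixed and the base point varies: this is the second-order
    information required for the Hessian. *)
Lemma is_diff_dsc_den v y :
  is_diff y (fun y => dsc_den y v) (fun h => sqnorm a * (2 * dot h v)).
Proof.
have -> : (fun y => dsc_den y v) =
    fun y => 2 * dot a v + sqnorm a * (2 * dot v y).
  by apply/funext => z; rewrite /dsc_den /dot; ring.
have d := is_diff_add (is_diff_const (2 * dot a v) y)
  (is_diff_scale (sqnorm a) (is_diff_scale 2 (is_diff_dot v y))).
by apply: (is_diff_eq d); apply/funext => h; rewrite /dot; ring.
Qed.

Lemma is_diff_dsc_num v y k :
  is_diff y (fun y => dsc_num y v 0 k) (fun h => 2 * dot h v * a 0 k).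
Proof.
have -> : (fun y => dsc_num y v 0 k) =
    fun y => v 0 k + 2 * a 0 k * dot v y.
  by apply/funext => z; rewrite /dsc_num !mxE /dot; ring.
have d := is_diff_add (is_diff_const (v 0 k) y)
  (is_diff_scale (2 * a 0 k) (is_diff_dot v y)).
by apply: (is_diff_eq d); apply/funext => h; rewrite /dot; ring.
Qed.

Lemma is_diff_sc y : sc_den y != 0 -> is_diff y sc (dsc y).
Proof.
move=> dy; apply: is_diff_row => k.
have -> : (fun y => sc y 0 k) =
    fun y => x0 0 k + l * (sc_num y 0 k * (sc_den y)^-1).
  by apply/funext => z; rewrite /sc !mxE; ring.
have d := is_diff_add (is_diff_const (x0 0 k) y) (is_diff_scale l
  (is_diff_mul (is_diff_sc_num y k) (is_diff_inv dy (is_diff_sc_den y)))).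
apply: (is_diff_eq d); apply/funext => v.
by rewrite /dsc /sc_num /dsc_num !mxE; field.
Qed.

Lemma near_sc_den y : 0 < sc_den y -> \forall z \near y, 0 < sc_den z.
Proof.
move=> dy; have [/differentiable_continuous c _] := is_diff_sc_den y.
exact: (cvgr_gt _ c).
Qed.

Lemma is_diff_special_conformal y : 0 < sc_den y ->
  is_diff y (finite_part special_conformal) (dsc y).
Proof.
move=> dy; apply: near_eq_is_diff (is_diff_sc _); last by rewrite gt_eqF.
near=> z; rewrite /finite_part special_conformalE//= gt_eqF//.
by near: z; exact: near_sc_den.
Unshelve. all: by end_near. Qed.

(** The two inversions have conformal factors 1/|y|^2 and 1/|z|^2, with |y|^2 |z|^2 = [sc_den y],
    and together preserve orientation. The proof checks the formula in coordinates, which also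
    covers y = 0. *)
Lemma det_special_conformal y : 0 < sc_den y ->
  \det ('J (finite_part special_conformal) y) = l ^+ 2 / sc_den y ^+ 2.
Proof.
move=> dy; have [dpsi dpsiE] := is_diff_special_conformal dy.
have JE i k : 'J (finite_part special_conformal) y i k = dsc y 'e_i 0 k.
  have := deriveEjacobian 'e_i dpsi; rewrite deriveE// dpsiE -rowE.
  by move=> /rowP/(_ k) ->; rewrite [RHS]mxE.
rewrite det_mx2 !JE /dsc /sc_num /dsc_num /dsc_den.
have := gt_eqF dy; rewrite /sc_den /dot !sqnormE !mxE /= => dn0.
by field; rewrite dn0.
Qed.

Lemma sc_den0 : sc_den 0 = 1.
Proof. by rewrite /sc_den /dot !sqnormE !mxE; ring. Qed.

Lemma sc0 : sc 0 = x0.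
Proof.
by apply/rowP => k; rewrite /sc /sc_num !sqnormE !mxE; ring.
Qed.

Lemma dsc0 v : dsc 0 v = l *: v.
Proof.
apply/rowP => k; rewrite /dsc /sc_num /dsc_num sc_den0 /dot !sqnormE !mxE.
by rewrite expr1n !invr1; ring.
Qed.

(** The bilinear form in [h] and [v] is the second differential at 0 of l (|y|^2 a - 2 (a.y) y). *)
Lemma is_diff_dsc0 v k : is_diff 0 (fun y => dsc y v 0 k) (fun h =>
  l * (2 * dot h v * a 0 k - 2 * dot a h * v 0 k - 2 * dot a v * h 0 k)).
Proof.
have -> : (fun y => dsc y v 0 k) = fun y =>
    l * ((sc_den y)^-1 * dsc_num y v 0 k + (- 1) *
      (dsc_den y v * ((sc_den y)^-1 * (sc_den y)^-1) * sc_num y 0 k)).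
  by apply/funext => z; rewrite /dsc /dsc_num /sc_num !mxE expr2 invfM; ring.
have dn0 : sc_den 0 != 0 by rewrite sc_den0 oner_neq0.
have di := is_diff_inv dn0 (is_diff_sc_den 0).
have d := is_diff_scale l (is_diff_add (is_diff_mul di (is_diff_dsc_num v 0 k))
  (is_diff_scale (- 1) (is_diff_mul (is_diff_mul (is_diff_dsc_den v 0)
    (is_diff_mul di di)) (is_diff_sc_num 0 k)))).
apply: (is_diff_eq d); apply/funext => h.
rewrite sc_den0 /dsc_den /dsc_num /sc_num /dot !sqnormE !mxE expr1n !invr1.
by ring.
Qed.

End SpecialConformal.

(** * Normalizing the 2-jet *)

Section Normalization.
Context {R : realType} (u : 'rV[R]_2 -> R) (x0 : 'rV[R]_2) (u2 : C2 u).

(** For general parameters the pullback has at 0 the value u(x0) + ln (l^2) and the gradient l grad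
    u(x0) - 4 a; these choices make both vanish. *)
Let l := expR (- u x0 / 2).
Let a : 'rV[R]_2 := (l / 4) *: gradient u x0.

Definition normalizing_map := special_conformal x0 a l.

Let w := pullback (finite_part normalizing_map) u.

Let sqrl : l ^+ 2 = expR (- u x0).
Proof. by rewrite /l -expRM_natl; congr expR; field. Qed.

Let den_gt0 : 0 < sc_den a 0.
Proof. by rewrite sc_den0. Qed.

Let den_neq0 : sc_den a 0 != 0.
Proof. by rewrite gt_eqF. Qed.

Lemma moebius_normalizing_map : moebius normalizing_map.
Proof. by apply: moebius_special_conformal; rewrite gt_eqF// expR_gt0. Qed.

Lemma normalizing_map0 : normalizing_map (Some 0) = Some x0.
Proof. by rewrite /normalizing_map special_conformalE// sc0. Qed.

Lemma near_pullback y : 0 < sc_den a y ->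
  \forall z \near y, u (sc x0 a l z) + (- u x0 + - 2 * ln (sc_den a z)) = w z.
Proof.
move=> dy; near=> z.
have dz : 0 < sc_den a z by near: z; exact: near_sc_den.
rewrite /w /pullback det_special_conformal//.
rewrite /finite_part /normalizing_map special_conformalE ?gt_eqF//=; congr (_ + _).
rewrite ger0_norm ?divr_ge0 ?sqr_ge0// ln_div ?posrE ?exprn_gt0// ?expR_gt0//.
by rewrite sqrl expRK lnXn// mulNr mulr_natl.
Unshelve. all: by end_near. Qed.

(** Stated on a whole neighbourhood of 0, since the Hessian differentiates this formula once more.
    Positivity of the denominator gives access to its logarithm. *)
Lemma is_diff_pullback y : 0 < sc_den a y -> is_diff y w (fun v =>
  dsc a l y v 0 0 * partial 0 u (sc x0 a l y)
  + dsc a l y v 0 1 * partial 1 u (sc x0 a l y)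
  + - 2 * ((sc_den a y)^-1 * dsc_den a y v)).
Proof.
move=> dy; have dy0 : sc_den a y != 0 by rewrite gt_eqF.
apply: near_eq_is_diff (near_pullback dy) _.
have d := is_diff_add (is_diff_comp_row (u2.1.1 _) (is_diff_sc x0 l dy0))
  (is_diff_add (is_diff_const (- u x0) y)
     (is_diff_scale (- 2) (is_diff_ln dy (is_diff_sc_den a y)))).
by apply: (is_diff_eq d); apply/funext => v; rewrite add0r.
Qed.

Lemma pullback_normalized : w 0 = 0.
Proof.
have /near_pullback/nbhs_singleton <- := den_gt0.
by rewrite sc0 sc_den0 ln1; ring.
Qed.

Lemma gradient_normalized : gradient w 0 = 0.
Proof.
apply/rowP => i; rewrite !mxE (partialE _ (is_diff_pullback den_gt0)).
rewrite sc0 dsc0 sc_den0 /dsc_den /dot /a /gradient !mxE.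
case: (ord2P i) => -> /=;
  move: (l) (partial 0 u x0) (partial 1 u x0) => *; by field.
Qed.

(** Three terms add up: the Hessian of [u] scaled by l^2 = exp (- u(x0)); the second differential of
    the map paired with grad u(x0) = 4 a / l, which is 8 |a|^2 I - 16 a⊗a; and the contribution - 4
    |a|^2 I + 8 a⊗a of - 2 ln [sc_den]. *)
Lemma hessian_normalized : hessian w 0 = - Amatrix u x0.
Proof.
apply/matrixP => i j; rewrite mxE.
have near_partial : \forall y \near (0 : 'rV[R]_2),
    dsc a l y 'e_j 0 0 * partial 0 u (sc x0 a l y)
    + dsc a l y 'e_j 0 1 * partial 1 u (sc x0 a l y)
    + - 2 * ((sc_den a y)^-1 * dsc_den a y 'e_j) = partial j w y.
  near=> y; rewrite (partialE _ (is_diff_pullback _))//.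
  by near: y; exact: near_sc_den.
have dp k := is_diff_comp_row ((u2.2 k).1 (sc x0 a l 0))
  (is_diff_sc x0 l den_neq0).
have di := is_diff_inv den_neq0 (is_diff_sc_den a 0).
have d := is_diff_add (is_diff_add
  (is_diff_mul (is_diff_dsc0 a l 'e_j 0) (dp 0))
  (is_diff_mul (is_diff_dsc0 a l 'e_j 1) (dp 1)))
  (is_diff_scale (- 2) (is_diff_mul di (is_diff_dsc_den a 'e_j 0))).
rewrite (partialE _ (near_eq_is_diff near_partial d)).
rewrite !sc0 !dsc0 sc_den0 !expr1n !invr1 /dsc_den /dot /Amatrix -sqrl.
rewrite !sqnormE /hessian !mxE.
case: (ord2P i) => ->; case: (ord2P j) => -> /=;
  (* The jet of [u] becomes independent variables, the two mixed derivatives separately, which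
     leaves a polynomial identity. *)
  move: (l) (partial 0 (partial 0 u) x0) (partial 0 (partial 1 u) x0)
    (partial 1 (partial 0 u) x0) (partial 1 (partial 1 u) x0)
    (partial 0 u x0) (partial 1 u x0) => *; by field.
Unshelve. all: by end_near. Qed.

End Normalization.

Theorem proposition1p4 (R : realType)
    (H : 'rV[R]_2 -> R -> 'rV[R]_2 -> sym2 R -> R)
    (Hinv : moebius_invariant H) :
  exists F : sym2 R -> R,
    orthogonally_invariant F /\
    forall u : 'rV[R]_2 -> R, C2 u ->
    forall x : 'rV[R]_2, eval_jet H u x = F (A_ u x).
Proof.
exists (fun M => H 0 0 0 (to_sym2 (- \val M))).
split; first exact: orthogonally_invariant_at0.
move=> u u2 x; rewrite /A_ to_sym2N.
have npole : ~ pole (normalizing_map u x) 0.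
  by rewrite /pole normalizing_map0.
have := Hinv _ (moebius_normalizing_map u x) u u2 0 npole.
rewrite {2}/finite_part normalizing_map0 /= => <-.
rewrite /eval_jet pullback_normalized// gradient_normalized//.
by rewrite hessian_normalized.
Qed.
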